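(* For the single-parameter exponential family $f_\theta(y)=c(\theta)h(y)e^{\theta T(y)}$, $\theta\in\Theta$, described in the context, the following hold. (1) $\lim_{n\to\infty}\int_{\mathbb{Y}}|f_{\theta_n}(y)-f_\theta(y)|\,\mu(dy)=0$ whenever $\theta_n,\theta\in\Theta$ and $\theta_n\to\theta$; and for any $\theta,\theta'\in\Theta$ the probability measures $\mu_\theta$ and $\mu_{\theta'}$ are mutually absolutely continuous. (2) For each $\theta\in\Theta_1$ there exists a strictly convex function $\phi_\theta:\mathbb{R}\to\mathbb{R}$ such that $f_\theta(y)/f_{\theta_0}(y)=\phi_\theta(T(y))$ for $y\in\mathbb{Y}$, understood as $f_\theta(y)=\phi_\theta(T(y))f_{\theta_0}(y)$.
   Context: Let $\mathbb{Y}\subset\mathbb{R}^{d_2}$ ($d_2\ge1$) and let $\mu$ be a $\sigma$-finite measure on $\mathbb{Y}$. Let $h:\mathbb{Y}\to[0,\infty)$ and $T:\mathbb{Y}\to\mathbb{R}$ be given measurable functions, and let $\mathcal{D}:=\{\theta\in\mathbb{R}: c(\theta)^{-1}:=\int_{\mathbb{Y}}h(y)e^{\theta T(y)}\,\mu(dy)<\infty\}$. Assume that $\mathcal{D}$ is open and that $\Theta\subset\mathcal{D}$ is compact. For $\theta\in\Theta$ let $f_\theta(y)=c(\theta)h(y)e^{\theta T(y)}$, a probability density with respect to $\mu$, and let $\mu_\theta$ be the probability measure with $d\mu_\theta/d\mu=f_\theta$. Let $\theta_0\in\Theta$ and $\Theta_1:=\Theta\setminus\{\theta_0\}$, assumed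 non-empty. *)

(* Defs.v *)
From HB Require Import structures.
From mathcomp Require Import all_boot all_order all_algebra.
From mathcomp Require Import all_classical all_reals all_analysis measurable_realfun.

Set Implicit Arguments.
Unset Strict Implicit.
Unset Printing Implicit Defensive.

Import Order.TTheory GRing.Theory Num.Theory.
Import numFieldNormedType.Exports.

Local Open Scope classical_set_scope.
Local Open Scope ring_scope.

(* A subset [Y] of a measurable space as a measurable space of its own, with
   the trace sigma-algebra (preimages of measurable sets under the inclusion).
   [Y] itself need not be measurable.  The proof of non-emptiness is needed
   because measurable types are pointed. *)
Definition trace_space d (S : measurableType d) (Y : set S)
  (Y0 : Y !=set0) : Type := set_type Y.

Section trace_space.
Context d (S : measurableType d) (Y : set S) (Y0 : Y !=set0).

HB.instance Definition _ := Choice.on (trace_space Y0).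
HB.instance Definition _ := isPointed.Build (trace_space Y0)
  (SigSub (mem_set (projT2 (cid Y0))) : set_type Y).

Let trace_val (y : trace_space Y0) : S := val (y : set_type Y).

HB.instance Definition _ := Measurable.copy (trace_space Y0)
  (g_sigma_algebra_preimageType trace_val).

End trace_space.

Section density_prob.
Local Open Scope ereal_scope.
Context d (Y : measurableType d) (R : realType).
Variables (mu : {measure set Y -> \bar R}) (f : Y -> R).
Hypotheses (f0 : forall y, (0 <= f y)%R) (mf : measurable_fun setT f).
Hypothesis f1 : \int[mu]_y (f y)%:E = 1.

(* The unused hypotheses are arguments so that the probability structure below
   can be inferred. *)
Definition density_prob of (forall y, (0 <= f y)%R) & measurable_fun setT f
    & \int[mu]_y (f y)%:E = 1 : set Y -> \bar R :=
  fun A => \int[mu]_(y in A) (f y)%:E.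

Local Notation P := (density_prob f0 mf f1).

Let P0 : P set0 = 0. Proof. by rewrite /density_prob integral_set0. Qed.

Let P_ge0 A : 0 <= P A.
Proof. by apply: integral_ge0 => y _; rewrite lee_fin. Qed.

Let P_sigma_additive : semi_sigma_additive P.
Proof.
by apply: semi_sigma_additive_nng_induced => //; exact/measurable_EFinP.
Qed.

HB.instance Definition _ :=
  isMeasure.Build _ _ _ P P0 P_ge0 P_sigma_additive.

HB.instance Definition _ := Measure_isProbability.Build _ _ _ P f1.

End density_prob.

Section exponential_family.
Context d (Y : measurableType d) (R : realType).
Variables (mu : {measure set Y -> \bar R}) (h T : Y -> R).

Definition expfam_mass (theta : R) : \bar R :=
  (\int[mu]_y (h y * expR (theta * T y))%:E)%E.

Definition expfam_dom : set R := [set theta | (expfam_mass theta < +oo)%E].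

(* The integral takes values in [0, +oo]; [fine] and the convention [0^-1 = 0]
   make this the real number c(theta) exactly when the integral is finite and
   nonzero.  A zero integral gives the zero function below, which is not a
   probability density. *)
Definition expfam_c (theta : R) : R := (fine (expfam_mass theta))^-1.

Definition expfam_pdf (theta : R) (y : Y) : R :=
  expfam_c theta * h y * expR (theta * T y).

Hypotheses (h0 : forall y, 0 <= h y) (mh : measurable_fun setT h).
Hypothesis mT : measurable_fun setT T.

Lemma expfam_pdf_ge0 theta y : 0 <= expfam_pdf theta y.
Proof.
rewrite !mulr_ge0 ?expR_ge0 // invr_ge0 fine_ge0 //.
by apply: integral_ge0 => z _; rewrite lee_fin mulr_ge0 ?expR_ge0.
Qed.

Lemma measurable_expfam_pdf theta : measurable_fun setT (expfam_pdf theta).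
Proof.
apply: measurable_funM; first exact: measurable_funM.
by apply: measurableT_comp => //; exact: measurable_funM.
Qed.

Definition expfam_prob (theta : R)
    (f1 : (\int[mu]_y (expfam_pdf theta y)%:E = 1)%E) : probability Y R :=
  density_prob (expfam_pdf_ge0 theta) (measurable_expfam_pdf theta) f1.

End exponential_family.

Definition strictly_convex (R : realType) (phi : R -> R) : Prop :=
  forall t x y : R, 0 < t < 1 -> x != y ->
    phi (t * x + (1 - t) * y) < t * phi x + (1 - t) * phi y.

(* Main.v *)
Require Import Defs.
From mathcomp Require Import all_boot all_order all_algebra.
From mathcomp Require Import all_classical all_reals all_analysis measurable_realfun.
From mathcomp Require Import ring lra.
Import Order.TTheory GRing.Theory Num.Theory.
Import numFieldNormedType.Exports.
Local Open Scope classical_set_scope.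
Local Open Scope ring_scope.

(** Everything follows from the formula [expfam_pdf_ratio]: on the support of
    [h], the ratio of the densities at [t] and [s] is a positive multiple of
    [expR ((t - s) * T y)].

    Seen as a function of [T y], for [t != s], this ratio is an exponential
    with nonzero rate, which is strictly convex because an exponential lies
    strictly above its tangents ([strictly_convex_scaled_expR]).  That one
    density is a pointwise multiple of the other also gives domination of the
    measures, in both directions by symmetry ([null_dominates_density]).

    For the convergence in L1, the normalising integral is a continuous
    function of the parameter on the open natural domain
    ([expfam_mass_continuous]).  Hence the densities converge pointwise along
    a convergent sequence of parameters, and pointwise convergence of
    probability densities to a probability density implies convergence in L1
    ([scheffe]). *)

(** The tangent at the barycentre [m = t * x + (1 - t) * y] lies strictly
    below the exponential at both [x] and [y]; averaging the two inequalities
    cancels the slope. *)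
Lemma strictly_convex_scaled_expR (R : realType) (k a : R) :
  0 < k -> a != 0 -> strictly_convex (fun t => k * expR (a * t)).
Proof.
move=> k0 a0 t x y /andP[t0 t1] xy.
set m := t * x + (1 - t) * y.
have tangent z : z != m -> expR (a * m) * (1 + a * (z - m)) < expR (a * z).
  move=> zm; have -> : a * z = a * m + a * (z - m) by ring.
  by rewrite expRD ltr_pM2l ?expR_gt0 ?expR_gt1Dx// mulf_neq0 ?subr_eq0.
have xm : x != m.
  rewrite -subr_eq0 (_ : x - m = (1 - t) * (x - y)); last by rewrite /m; ring.
  by rewrite mulf_neq0// subr_eq0// gt_eqF.
have ym : y != m.
  rewrite -subr_eq0 (_ : y - m = - (t * (x - y))); last by rewrite /m; ring.
  by rewrite oppr_eq0 mulf_neq0 ?subr_eq0//; exact: lt0r_neq0.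
have tx : t * (expR (a * m) * (1 + a * (x - m))) < t * expR (a * x).
  by rewrite ltr_pM2l ?tangent.
have ty : (1 - t) * (expR (a * m) * (1 + a * (y - m))) < (1 - t) * expR (a * y).
  by rewrite ltr_pM2l ?subr_gt0 ?tangent.
rewrite ![_ * (k * _)]mulrCA -mulrDr ltr_pM2l//.
(* the slope terms cancel at the barycentre *)
have -> : expR (a * m) = t * (expR (a * m) * (1 + a * (x - m))) +
    (1 - t) * (expR (a * m) * (1 + a * (y - m))).
  set e := expR (a * m); rewrite /m; ring.
exact: ltrD.
Qed.

Lemma integrable_density d (Y : measurableType d) (R : realType)
    (mu : {measure set Y -> \bar R}) (f : Y -> R) :
  (forall y, 0 <= f y) -> measurable_fun setT f ->
  (\int[mu]_y (f y)%:E < +oo)%E -> mu.-integrable setT (EFin \o f).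
Proof.
move=> f0 mf fin; apply/integrableP; split; first exact/measurable_EFinP.
by under eq_integral => y _ do rewrite /= ger0_norm//.
Qed.

(** Scheffe's lemma.  One has [`|p_ n - p| = (p_ n - p) + u n], where
    [u n = (p - p_ n) + `|p - p_ n|] is twice the positive part of [p - p_ n].
    The first term integrates to [1 - 1 = 0].  The second is at most [2 p],
    because [p_ n] is nonnegative, and so tends to [0] in mean by dominated
    convergence. *)
Lemma scheffe d (Y : measurableType d) (R : realType)
    (mu : {measure set Y -> \bar R}) (p_ : nat -> Y -> R) (p : Y -> R) :
  (forall n y, 0 <= p_ n y) -> (forall y, 0 <= p y) ->
  (forall n, measurable_fun setT (p_ n)) -> measurable_fun setT p ->
  (forall n, \int[mu]_y (p_ n y)%:E = 1)%E -> (\int[mu]_y (p y)%:E = 1)%E ->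
  (forall y, p_ n y @[n --> \oo] --> p y) ->
  (\int[mu]_y (`|p_ n y - p y|)%:E)%E @[n --> \oo] --> 0%E.
Proof.
move=> p_0 p0 mp_ mp p_1 p1 p_p.
pose u n y := (p y - p_ n y) + `|p y - p_ n y|.
have mu_ n : measurable_fun setT (u n).
  have mB : measurable_fun setT (fun y => p y - p_ n y).
    exact: measurable_funB.
  by apply: measurable_funD => //; exact: measurableT_comp.
have ip_ n : mu.-integrable setT (EFin \o p_ n).
  by apply: integrable_density; rewrite ?p_1 ?ltry.
have ip : mu.-integrable setT (EFin \o p).
  by apply: integrable_density; rewrite ?p1 ?ltry.
have i2p : mu.-integrable setT (EFin \o (fun y => p y *+ 2)).
  have := integrableD measurableT ip ip.
  by apply: eq_integrable => // y _ /=; rewrite -EFinD mulr2n.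
have u_le n y : 0 <= u n y <= p y *+ 2.
  have := p_0 n y; have := p0 y; rewrite /u mulr2n => py pny.
  by have [h|/ltW h] := leP (p y - p_ n y) 0;
    [rewrite ler0_norm//|rewrite ger0_norm//]; lra.
have iu n : mu.-integrable setT (EFin \o u n).
  apply: le_integrable i2p => //; first exact/measurable_EFinP.
  move=> y _ /=; have /andP[u0 u2] := u_le n y.
  by rewrite lee_fin !ger0_norm// (le_trans u0).
have -> : (fun n => \int[mu]_y (`|p_ n y - p y|)%:E)%E =
          (fun n => \int[mu]_y (u n y)%:E)%E.
  apply/funext => n.
  transitivity (\int[mu]_y (((p_ n y)%:E - (p y)%:E) + (u n y)%:E))%E.
    apply: eq_integral => y _; rewrite -EFinB -EFinD; congr EFin.
    by rewrite /u (distrC (p y)); ring.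
  rewrite (integralD measurableT (integrableB measurableT (ip_ n) ip) (iu n))/=.
  by rewrite integralB_EFin// p_1 p1 subee// add0e.
have [] := @dominated_convergence _ _ _ mu setT measurableT
  (fun n y => (u n y)%:E) (cst 0%E) (EFin \o (fun y => p y *+ 2)) _ _ _ i2p _.
- by move=> n; exact/measurable_EFinP.
- by [].
- apply: aeW => y _; apply: cvg_EFin; first by apply: nearW.
  have d0 : p y - p_ n y @[n --> \oo] --> 0.
    by rewrite -(subrr (p y)); apply: cvgB => //; exact: cvg_cst.
  rewrite -[0](addr0 0) -[X in _ --> _ + X](normr0 R).
  by apply: cvgD => //; exact: cvg_norm.
- apply: aeW => y n _ /=; have /andP[u0 u2] := u_le n y.
  by rewrite lee_fin ger0_norm.
- by move=> _ _; rewrite integral0.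
Qed.

(** Choose [r > 0] such that the closed interval [theta - r, theta + r] is in
    the domain.  For [t] inside it, [t * T y] is at most its value at the
    right endpoint if [T y >= 0] and at the left endpoint otherwise, so the
    sum of the two endpoint integrands is an integrable bound that does not
    depend on [t]. *)
Lemma expfam_mass_continuous d (Y : measurableType d) (R : realType)
    (mu : {measure set Y -> \bar R}) (h T : Y -> R) (theta : R) :
  (forall y, 0 <= h y) -> measurable_fun setT h -> measurable_fun setT T ->
  open (expfam_dom mu h T) -> expfam_dom mu h T theta ->
  {for theta, continuous (fun t => fine (expfam_mass mu h T t))}.
Proof.
move=> h0 mh mT oD Dtheta.
have [r r0 rD] : exists2 r : R, 0 < r &
    `[theta - r, theta + r] `<=` expfam_dom mu h T.
  have [e /= e0 eD] := oD _ Dtheta.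
  (* half the radius of an open ball, so that the endpoints are inside *)
  exists (e / 2); first by rewrite divr_gt0.
  move=> t /=; rewrite in_itv/= => /andP[t1 t2]; apply: eD => /=.
  rewrite ltr_norml; apply/andP; split; lra.
pose w t y := h y * expR (t * T y).
have w0 t y : 0 <= w t y by rewrite mulr_ge0 ?expR_ge0.
have iw t : expfam_dom mu h T t -> mu.-integrable setT (EFin \o w t).
  apply: integrable_density; first exact: w0.
  apply: measurable_funM => //.
  by apply: measurableT_comp => //; exact: measurable_funM.
pose g y := w (theta - r) y + w (theta + r) y.
apply: (@continuity_under_integral R _ Y mu w setT measurableT
  (theta - r) (theta + r) _ _ g _ _ theta).
- move=> t /=; rewrite in_itv/= => /andP[t1 t2]; apply: iw; apply: rD => /=.
  by rewrite in_itv/= !ltW.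
- apply: aeW => y _ t _; apply: cvgM; first exact: cvg_cst.
  apply: continuous_comp; last exact: continuous_expR.
  by apply: cvgM; [exact: cvg_id|exact: cvg_cst].
- have D1 : expfam_dom mu h T (theta - r)
    by apply: rD => /=; rewrite in_itv/=; lra.
  have D2 : expfam_dom mu h T (theta + r)
    by apply: rD => /=; rewrite in_itv/=; lra.
  exact: (integrableD measurableT (iw _ D1) (iw _ D2)).
- move=> t /=; rewrite in_itv/= => /andP[t1 t2]; apply: aeW => y _.
  rewrite ger0_norm// /g /w -mulrDr ler_wpM2l//.
  have [T0|T0] := leP 0 (T y).
  + by rewrite ler_wpDl ?expR_ge0// ler_expR ler_wpM2r// ltW.
  + by rewrite ler_wpDr ?expR_ge0// ler_expR ler_wnM2r// ltW.
- by rewrite inE/= in_itv/=; lra.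
Qed.

(** If the normalising constant were zero (integral zero, or infinite, which
    [fine] sends to zero), the density would vanish identically and could not
    have integral one. *)
Lemma expfam_c_gt0 d (Y : measurableType d) (R : realType)
    (mu : {measure set Y -> \bar R}) (h T : Y -> R) (theta : R) :
  (forall y, 0 <= h y) ->
  (\int[mu]_y (expfam_pdf mu h T theta y)%:E = 1)%E ->
  0 < expfam_c mu h T theta.
Proof.
move=> h0 pdf1; rewrite lt_neqAle eq_sym invr_ge0 fine_ge0 ?andbT; last first.
  by apply: integral_ge0 => y _; rewrite lee_fin mulr_ge0 ?expR_ge0.
apply/eqP => c0; move: pdf1; rewrite /expfam_pdf c0.
under eq_integral do rewrite !mul0r.
by rewrite integral0 => -[] /esym/eqP; rewrite oner_eq0.
Qed.

Lemma expfam_pdf_ratio d (Y : measurableType d) (R : realType)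
    (mu : {measure set Y -> \bar R}) (h T : Y -> R) (s t : R) :
  expfam_c mu h T s != 0 -> forall y, expfam_pdf mu h T t y =
    (expfam_c mu h T t / expfam_c mu h T s * expR ((t - s) * T y))
    * expfam_pdf mu h T s y.
Proof.
move=> cs y; rewrite /expfam_pdf.
have -> : t * T y = (t - s) * T y + s * T y by ring.
by rewrite expRD; field.
Qed.

(** If [g] has integral zero over [A] then it vanishes almost everywhere on
    [A], and so does each of its pointwise multiples. *)
Lemma null_dominates_density d (Y : measurableType d) (R : realType)
    (mu : {measure set Y -> \bar R}) (f g w : Y -> R)
    (f0 : forall y, 0 <= f y) (mf : measurable_fun setT f)
    (f1 : (\int[mu]_y (f y)%:E = 1)%E)
    (g0 : forall y, 0 <= g y) (mg : measurable_fun setT g)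
    (g1 : (\int[mu]_y (g y)%:E = 1)%E) :
  (forall y, f y = w y * g y) ->
  density_prob f0 mf f1 `<< density_prob g0 mg g1.
Proof.
move=> fwg N gN A mA AN.
have mEg : measurable_fun A (EFin \o g).
  by apply/measurable_EFinP; exact: measurable_funTS.
have mEf : measurable_fun A (EFin \o f).
  by apply/measurable_EFinP; exact: measurable_funTS.
have gA : ae_eq mu A (EFin \o g) (cst 0%E).
  apply/(ae_eq_integral_abs mu mA mEg).
  under eq_integral => y _ do rewrite /= ger0_norm//.
  exact: gN A mA AN.
rewrite /density_prob -(integral0 mu A); apply: ae_eq_integral => //.
by apply: filterS gA => y gy Ay; have /= [gy0] := gy Ay; rewrite fwg gy0 mulr0.
Qed.

Theorem corollary7 (R : realType) (d2 : nat) (hd2 : (1 <= d2)%N)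
  (Y : set (d2.-tuple R)) (Y0 : Y !=set0)
  (mu : {sigma_finite_measure set (trace_space Y0) -> \bar R})
  (h T : trace_space Y0 -> R)
  (h0 : forall y, 0 <= h y)
  (mh : measurable_fun [set: trace_space Y0] h)
  (mT : measurable_fun [set: trace_space Y0] T)
  (Theta : set R)
  (D_open : open (expfam_dom mu h T))
  (Theta_sub : Theta `<=` expfam_dom mu h T)
  (Theta_compact : compact Theta)
  (pdf1 : forall theta, Theta theta ->
    (\int[mu]_y (expfam_pdf mu h T theta y)%:E = 1)%E)
  (theta0 : R) (Theta_theta0 : Theta theta0)
  (Theta1_neq0 : Theta `\ theta0 !=set0) :
  ((forall (thetan : nat -> R) (theta : R),
      (forall n, Theta (thetan n)) -> Theta theta ->
      thetan n @[n --> \oo] --> theta ->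
      (\int[mu]_y (`|expfam_pdf mu h T (thetan n) y
                     - expfam_pdf mu h T theta y|)%:E)%E
        @[n --> \oo] --> 0%E)
   /\
   (forall (theta theta' : R) (ht : Theta theta) (ht' : Theta theta'),
      expfam_prob h0 mh mT (pdf1 theta ht)
        `<< expfam_prob h0 mh mT (pdf1 theta' ht')
      /\ expfam_prob h0 mh mT (pdf1 theta' ht')
        `<< expfam_prob h0 mh mT (pdf1 theta ht)))
  /\
  (forall theta : R, (Theta `\ theta0) theta ->
     exists phi : R -> R, strictly_convex phi /\
       forall y, expfam_pdf mu h T theta y
                 = phi (T y) * expfam_pdf mu h T theta0 y).
Proof.
have c0 theta : Theta theta -> 0 < expfam_c mu h T theta.
  by move=> /pdf1; exact: expfam_c_gt0.
have ac theta theta' (ht : Theta theta) (ht' : Theta theta') :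
    expfam_prob h0 mh mT (pdf1 theta ht)
      `<< expfam_prob h0 mh mT (pdf1 theta' ht').
  apply: null_dominates_density; apply: expfam_pdf_ratio.
  by rewrite gt_eqF ?c0.
split; [split|].
- move=> thetan theta Theta_n Theta_theta thetan_theta.
  apply: scheffe => [n y|y|n||n||y].
  + exact: expfam_pdf_ge0.
  + exact: expfam_pdf_ge0.
  + exact: measurable_expfam_pdf.
  + exact: measurable_expfam_pdf.
  + by apply/pdf1.
  + by apply/pdf1.
  have cM := @expfam_mass_continuous _ _ _ mu h T theta h0 mh mT D_open
    (Theta_sub _ Theta_theta).
  apply: cvgM.
    apply: cvgM; last exact: cvg_cst.
    apply: cvgV; last exact: (cvg_comp _ _ thetan_theta cM).
    by rewrite -invr_eq0 gt_eqF ?c0.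
  apply: (cvg_comp (fun n => thetan n * T y) expR); last exact: continuous_expR.
  by apply: cvgM => //; exact: cvg_cst.
- by move=> s t hs ht; split; exact: ac.
- move=> theta [ht theta_neq].
  exists (fun x => expfam_c mu h T theta / expfam_c mu h T theta0
                   * expR ((theta - theta0) * x)); split.
    apply: strictly_convex_scaled_expR; first by rewrite divr_gt0 ?c0.
    by rewrite subr_eq0; exact/eqP.
  by apply: expfam_pdf_ratio; rewrite gt_eqF ?c0.
Qed.
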